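(* Let $q\ge 3$ and let $V_{\rm Abel}=\left\langle \frac{\partial}{\partial x},x\frac{\partial}{\partial x},\ldots,x^q\frac{\partial}{\partial x}\right\rangle$, a space of vector fields on $\mathbb{R}$. If $\varphi:\mathbb{R}\to\mathbb{R}$ is a diffeomorphism such that $\varphi_*$ maps elements of $V_{\rm Abel}$ to elements of $V_{\rm Abel}$, then there exist $k_0\in\mathbb{R}\setminus\{0\}$ and $k_1\in\mathbb{R}$ such that $\varphi(x)=k_0x+k_1$ for all $x\in\mathbb{R}$.
   Context: Here $\varphi_*$ is the push-forward of vector fields by $\varphi$ and $\langle\cdot\rangle$ denotes the real linear span. Such $\varphi$ are the ($t$-independent) Lie almost symmetries of Abel equations of degree $q$, $dx/dt=f_0(t)+f_1(t)x+\cdots+f_q(t)x^q$. *)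

(* Defs.v *)
From mathcomp Require Import all_boot all_order all_algebra.
From mathcomp Require Import all_classical all_reals all_analysis.
Import Order.TTheory GRing.Theory Num.Theory.
Import numFieldNormedType.Exports.

Set Implicit Arguments.
Unset Strict Implicit.
Unset Printing Implicit Defensive.

Local Open Scope ring_scope.
Local Open Scope classical_set_scope.

(* C^oo on the whole real line *)
Definition smooth (R : realType) (f : R -> R) : Prop :=
  forall (n : nat) (x : R), derivable (f^`(n)) x 1.

Record diffeomorphism (R : realType) := Diffeomorphism {
  diffeo_fun :> R -> R;
  diffeo_inv : R -> R;
  diffeo_funK : cancel diffeo_fun diffeo_inv;
  diffeo_invK : cancel diffeo_inv diffeo_fun;
  diffeo_smooth : smooth diffeo_fun;
  diffeo_inv_smooth : smooth diffeo_inv }.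

(* The vector field f d/dx on the real line is represented by its coefficient
   f : R -> R in the global frame d/dx.  In this frame, the tangent map of phi
   at x is multiplication by phi'(x), so that
   (phi_* X)_y = T_{phi^-1 y} phi (X_{phi^-1 y}) reads as follows. *)
Definition vf_pushforward (R : realType) (phi : diffeomorphism R) (X : R -> R) :
    R -> R :=
  fun y => derive1 phi (diffeo_inv phi y) * X (diffeo_inv phi y).

Definition linear_span (K : nzRingType) (V : lmodType K) (I : finType)
    (v : I -> V) : set V :=
  [set w | exists c : I -> K, w = \sum_(i : I) c i *: v i].

(* x^i d/dx *)
Definition monomial_field (R : realType) (i : nat) : R -> R :=
  fun x => x ^+ i.

Definition V_Abel (R : realType) (q : nat) : set (R -> R) :=
  linear_span (fun i : 'I_q.+1 => @monomial_field R i).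
Arguments V_Abel : clear implicits.

(* Main.v *)
Require Import Defs.
From mathcomp Require Import all_boot all_order all_algebra.
From mathcomp Require Import all_classical all_reals all_analysis.
Import Order.TTheory GRing.Theory Num.Theory.
Import numFieldNormedType.Exports.

Local Open Scope ring_scope.
Local Open Scope classical_set_scope.

(** Let [psi] be the inverse of [phi]. The push-forward of [x^i d/dx] has
    coefficient [psi^i * g] with [g = phi' \o psi], so [g = P0], [psi * g = P1]
    and [psi^q * g = Pq] are polynomials of degree at most [q], and [P0] has no
    real root because [g * psi' = 1]. Write [P0 = d a] and [P1 = d b] with [a]
    and [b] coprime. From [P1^q = P0^(q-1) Pq], that is [d b^q = a^(q-1) Pq],
    we get that [a^(q-1)] divides [d], so [a^q] divides [P0] and [a] has
    degree at most 1; having no real root, [a] is constant. Hence [psi] is a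
    polynomial, and [psi^q * P0 = Pq] forces its degree to be at most 1. *)

Lemma horner_inj (R : numDomainType) (p p' : {poly R}) :
  (forall x, p.[x] = p'.[x]) -> p = p'.
Proof.
move=> epp'; apply/eqP; rewrite -subr_eq0; apply/negPn/negP => nz.
(* In characteristic zero these integers are distinct, and there is one root too many for a nonzero
   [p - p']. *)
pose s : seq R := [seq k%:R | k <- iota 0 (size (p - p'))].
have : (size s < size (p - p')%R)%N.
  apply: max_poly_roots => //.
    by apply/allP => x _; rewrite /root hornerD hornerN epp' subrr.
  by rewrite map_inj_uniq ?iota_uniq // => m n /eqP; rewrite eqr_nat => /eqP.
by rewrite size_map size_iota ltnn.
Qed.

Lemma dvdp_exp_coprime {F : fieldType} {n : nat} {p0 p1 pn : {poly F}} :
  p0 != 0 -> p1 ^+ n.+1 = p0 ^+ n * pn ->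
  exists a b d : {poly F}, [/\ p0 = d * a, p1 = d * b & a ^+ n.+1 %| p0]%R.
Proof.
move=> nz0 e; set d := gcdp p0 p1.
have nzd : d != 0 by rewrite gcdp_eq0 negb_and nz0.
have e0 : p0 = d * (p0 %/ d) by rewrite mulrC divpK // dvdp_gcdl.
have e1 : p1 = d * (p1 %/ d) by rewrite mulrC divpK // dvdp_gcdr.
have cop : coprimep (p0 %/ d) (p1 %/ d) by rewrite coprimep_div_gcd // nz0.
move: (p0 %/ d) (p1 %/ d) e0 e1 cop => a b e0 e1 cop.
exists a, b, d; split => //.
have edb : d * b ^+ n.+1 = a ^+ n * pn.
  apply: (mulfI (expf_neq0 n nzd)).
  by rewrite !mulrA -exprSr -!exprMn -e0 -e1.
(* Cancelling one factor [a] leaves [a ^+ n %| d], which Gauss's lemma extracts from [edb], as [a]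
   is coprime to [b]. *)
rewrite e0 exprSr dvdp_mul2r; last first.
  by apply: contraNneq nz0 => a0; rewrite e0 a0 mulr0.
rewrite -(Gauss_dvdpl (q := b ^+ n.+1) d) ?edb ?dvdp_mulr //.
by rewrite coprimep_expl // coprimep_expr.
Qed.

Lemma size_exp_leq2 {R : idomainType} {n : nat} {p : {poly R}} :
  (0 < n)%N -> (size (p ^+ n) <= n.+1)%N -> (size p <= 2)%N.
Proof.
move=> n0; rewrite -add1n -leq_subLR subn1 size_exp -[leqRHS]mul1n.
by rewrite leq_pmul2r // -subn1 leq_subLR.
Qed.

(** The base field need not be algebraically closed, so the exponent serves to bring the degree of
    [a] down to at most 1; a linear [a] has a root, and [p] would inherit it. *)
Lemma size_rootless_exp_dvdp {F : fieldType} {n : nat} {a p : {poly F}} :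
  (0 < n)%N -> (size p <= n.+1)%N -> (forall x, ~~ root p x) ->
  a ^+ n %| p -> size a = 1%N.
Proof.
move=> n0 szp nrp dvd.
have nzp : p != 0 by apply: contraNneq (nrp 0) => ->; rewrite root0.
have nza : a != 0.
  by apply: contraTneq dvd => ->; rewrite expr0n gtn_eqF //= dvd0p.
have sza := size_exp_leq2 n0 (leq_trans (dvdp_leq nzp dvd) szp).
apply/eqP; rewrite eqn_leq size_poly_gt0 nza andbT leqNgt.
apply/negP => sza1; have /poly2_root[r ra] : size a = 2%N.
  by apply/eqP; rewrite eqn_leq sza.
apply/negP: (nrp r); rewrite negbK.
rewrite -dvdp_XsubCl (dvdp_trans _ dvd) // dvdp_XsubCl.
by rewrite /root horner_exp (eqP ra) expr0n gtn_eqF.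
Qed.

Lemma V_Abel_poly {R : realType} {q : nat} {X : R -> R} :
  V_Abel R q X ->
  exists p : {poly R}, (size p <= q.+1)%N /\ forall x, X x = p.[x].
Proof.
case=> c ->; exists (\sum_(i < q.+1) c i *: 'X^i); split.
  apply: (leq_trans (size_sum _ _ _)); apply/bigmax_leqP => i _.
  by rewrite (leq_trans (size_scale_leq _ _)) // size_polyXn.
move=> x; rewrite fct_sumE horner_sum; apply: eq_bigr => i _.
by rewrite hornerZ hornerXn.
Qed.

Lemma V_Abel_monomial {R : realType} {q i : nat} :
  (i <= q)%N -> V_Abel R q (@monomial_field R i).
Proof.
rewrite -ltnS => iq; exists (fun j => (j == Ordinal iq)%:R).
rewrite (bigD1 (Ordinal iq)) //= eqxx scale1r big1 ?addr0 // => j /negbTE ->.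
by rewrite scale0r.
Qed.

Lemma diffeo_derive_neq0 {R : realType} (phi : diffeomorphism R) (x : R) :
  derive1 phi x != 0.
Proof.
have e : (diffeo_inv phi \o phi)^`()%classic x = 1.
  have -> : diffeo_inv phi \o phi = id by apply/funext/diffeo_funK.
  by rewrite derive1_id.
apply/eqP => d0; move/eqP: e.
rewrite derive1_comp ?d0 ?mulr0 1?eq_sym ?oner_eq0 //.
(* Order 0 of smoothness is derivability of the map itself. *)
- exact: (@diffeo_smooth _ phi 0).
- exact: (@diffeo_inv_smooth _ phi 0).
Qed.

Theorem mainTheorem2 (R : realType) (q : nat) (hq : (3 <= q)%N)
    (phi : diffeomorphism R)
    (hphi : forall X : R -> R, V_Abel R q X -> V_Abel R q (vf_pushforward phi X)) :
  exists k0 k1 : R, k0 != 0 /\ forall x : R, phi x = k0 * x + k1.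
Proof.
set psi := diffeo_inv phi; pose g y := derive1 phi (psi y).
have image i : (i <= q)%N -> exists p : {poly R},
    (size p <= q.+1)%N /\ forall y, g y * psi y ^+ i = p.[y].
  by move=> /V_Abel_monomial /hphi /V_Abel_poly.
have q0 : (0 < q)%N by apply: leq_trans hq.
have [p0 [sz0 E0]] := image 0%N isT.
have [p1 [_ E1]] := image 1%N q0.
have [pq [szq Eq]] := image q (leqnn q).
have nr0 y : ~~ root p0 y.
  by rewrite /root -E0 expr0 mulr1 diffeo_derive_neq0.
have nz0 : p0 != 0 by apply: contraNneq (nr0 0) => ->; rewrite root0.
(* At [y] both sides equal [g y ^+ q * psi y ^+ q]. *)
have e : p1 ^+ q.-1.+1 = p0 ^+ q.-1 * pq.
  apply: horner_inj => y; rewrite hornerM !horner_exp -E0 -E1 -Eq prednK //.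
  by rewrite expr0 mulr1 expr1 exprMn mulrA -exprSr prednK.
have [a [b [d [e0 e1]]]] := dvdp_exp_coprime nz0 e.
rewrite prednK // => /(size_rootless_exp_dvdp q0 sz0 nr0) /eqP /size_poly1P.
case=> c nzc ea.
(* As [a] is the constant [c], the quotient [p1 / p0] is [d b / (d c)]. *)
pose B := c^-1 *: b.
have psiE y : psi y = B.[y].
  have nzp0 : p0.[y] != 0 by exact: nr0.
  apply: (mulfI nzp0); rewrite -{1}E0 expr0 mulr1 -[psi y]expr1 E1.
  by rewrite e1 e0 ea /B !(hornerM, hornerZ, hornerC) -mulrA mulVKf.
have eB : B ^+ q * p0 = pq.
  apply: horner_inj => y.
  by rewrite hornerM horner_exp -psiE -Eq -E0 expr0 mulr1 mulrC.
have szB : (size B <= 2)%N.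
  (* Divisibility bounds the degree only when [pq] is nonzero, so [B = 0] is set apart. *)
  have [->|nzB] := eqVneq B 0; first by rewrite size_poly0.
  have dvd : B ^+ q %| pq by rewrite -eB dvdp_mulr.
  have nzq : pq != 0 by rewrite -eB mulf_neq0 ?expf_neq0.
  exact: size_exp_leq2 q0 (leq_trans (dvdp_leq nzq dvd) szq).
have affine x : x = B`_1 * phi x + B`_0.
  rewrite -[LHS](diffeo_funK phi) -/psi psiE (horner_coef_wide _ szB).
  by rewrite big_ord_recl big_ord1 /= expr0 mulr1 expr1 addrC.
have nzB1 : B`_1 != 0.
  apply/eqP => B1; have := affine 0; have := affine 1.
  by rewrite B1 !mul0r !add0r => <- /eqP; rewrite eq_sym oner_eq0.
exists (B`_1)^-1, (- ((B`_1)^-1 * B`_0)); split; first by rewrite invr_eq0.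
by move=> x; rewrite -mulrBr [in RHS](affine x) addrK mulKf.
Qed.
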